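(* The PPT exact entanglement cost is not generally convex. That is, there exist finite-dimensional Hilbert spaces $\mathcal{H}_A,\mathcal{H}_B$, a finite probability distribution $p(z)$, and bipartite states $\{\rho^z_{AB}\}_z$ on $\mathcal{H}_A\otimes\mathcal{H}_B$ such that, with $\overline{\rho}_{AB}:=\sum_z p(z)\rho^z_{AB}$, $$E_{\mathrm{PPT}}(\overline{\rho}_{AB})>\sum_z p(z)E_{\mathrm{PPT}}(\rho^z_{AB}).$$
   Context: A bipartite state $\rho_{AB}$ is a positive semi-definite operator of unit trace on $\mathcal{H}_A\otimes\mathcal{H}_B$. The partial transpose with respect to a fixed orthonormal basis $\{|i\rangle_B\}_i$ is the linear map $T_B(X_{AB})=X_{AB}^{T_B}:=\sum_{i,j}(I_A\otimes|i\rangle\langle j|_B)X_{AB}(I_A\otimes|i\rangle\langle j|_B)$. A quantum channel is a completely positive trace-preserving map. A bipartite channel $\mathcal{N}_{AB\to A'B'}$ (Alice holds $A,A'$, Bob holds $B,B'$) is completely PPT-preserving (C-PPT-P), written $\mathcal{N}\in\mathrm{PPT}$, if $T_{B'}\circ\mathcal{N}_{AB\to A'B'}\circ T_B$ is completely positive. For $d\in\mathbb{N}=\{1,2,\dots\}$, the maximally entangled state of Schmidt rank $d$ is $\Phi^d_{\hat A\hat B}:=\frac1d\sum_{i,j=1}^d|i\rangle\langle j|_{\hat A}\otimes|i\rangle\langle j|_{\hat B}$, where $\hat A,\hat B$ have dimension $d$ with orthonormal bases $\{|i\rangle_{\hat A}\}_i$, $\{|i\rangle_{\hat B}\}_i$.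 One-shot PPT exact entanglement cost: $E^{(1)}_{\mathrm{PPT}}(\rho_{AB}):=\inf\{\log_2 d: d\in\mathbb{N},\ \Lambda_{\hat A\hat B\to AB}\in\mathrm{PPT},\ \rho_{AB}=\Lambda_{\hat A\hat B\to AB}(\Phi^d_{\hat A\hat B})\}$. PPT exact entanglement cost: $E_{\mathrm{PPT}}(\rho_{AB}):=\limsup_{n\to\infty}\frac1n E^{(1)}_{\mathrm{PPT}}(\rho_{AB}^{\otimes n})$, where $\rho_{AB}^{\otimes n}$ is regarded as bipartite with respect to the cut $A^n|B^n$. An entanglement measure $E$ is convex if $E(\sum_z p(z)\rho^z_{AB})\le\sum_z p(z)E(\rho^z_{AB})$ for all probability distributions $p$ and states $\rho^z_{AB}$. *)

(* Defs.v *)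
From HB Require Import structures.
From mathcomp Require Import all_boot all_order all_algebra.
From mathcomp Require Import all_classical all_reals all_analysis.
From mathcomp Require Import complex mxtens.

Set Implicit Arguments.
Unset Strict Implicit.
Unset Printing Implicit Defensive.

Import Order.TTheory GRing.Theory Num.Theory.
Import numFieldNormedType.Exports.

Local Open Scope classical_set_scope.
Local Open Scope complex_scope.
Local Open Scope ring_scope.

(* An operator on C^a (x) C^b is a matrix of size a * b, with the index of
   e_i (x) e_j given by mxtens_index (i, j), so that *t is the tensor product;
   the first factor is Alice's and the second one Bob's. *)

(* Over C, nonnegativity of <v, X v> for all v already forces X to be
   Hermitian: in R[i], 0 <= z entails that z is real. *)
Definition psd (R : realType) (n : nat) (X : 'M[R[i]]_n) : Prop :=
  forall v : 'cV[R[i]]_n, 0 <= ((map_mx Num.conj v)^T *m X *m v) 0 0.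

Definition is_state (R : realType) (n : nat) (rho : 'M[R[i]]_n) : Prop :=
  psd rho /\ \tr rho = 1.

(* T_B(X) = \sum_(i, j) (I (x) |i><j|) X (I (x) |i><j|); both factors are
   indeed |i><j|, neither is its adjoint. *)
Definition ptrans (R : realType) (a b : nat) (X : 'M[R[i]]_(a * b)) :
    'M[R[i]]_(a * b) :=
  \sum_(i < b) \sum_(j < b)
    (1%:M *t delta_mx i j) *m X *m (1%:M *t delta_mx i j).

Lemma ptrans_is_linear (R : realType) (a b : nat) :
  linear (@ptrans R a b).
Proof.
move=> c X Y; rewrite /ptrans scaler_sumr -big_split /=.
apply: eq_bigr => i _; rewrite scaler_sumr -big_split /=.
by apply: eq_bigr => j _; rewrite mulmxDr mulmxDl -scalemxAr -scalemxAl.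
Qed.

HB.instance Definition _ (R : realType) (a b : nat) :=
  GRing.isLinear.Build R[i] 'M[R[i]]_(a * b) 'M[R[i]]_(a * b) *:%R
    (@ptrans R a b) (@ptrans_is_linear R a b).

(* The operator X_(i,j) in X = \sum_(i, j) |i><j| (x) X_(i,j). *)
Definition tens_block (R : realType) (k p : nat) (X : 'M[R[i]]_(k * p))
    (i j : 'I_k) : 'M[R[i]]_p :=
  \matrix_(s, t) X (mxtens_index (i, s)) (mxtens_index (j, t)).

(* id_k (x) L *)
Definition id_tens (R : realType) (k p q : nat)
    (L : {linear 'M[R[i]]_p -> 'M[R[i]]_q}) (X : 'M[R[i]]_(k * p)) :
    'M[R[i]]_(k * q) :=
  \sum_(i < k) \sum_(j < k) delta_mx i j *t L (tens_block X i j).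

Definition completely_positive (R : realType) (p q : nat)
    (L : {linear 'M[R[i]]_p -> 'M[R[i]]_q}) : Prop :=
  forall (k : nat) (X : 'M[R[i]]_(k * p)), psd X -> psd (id_tens L X).

Definition trace_preserving (R : realType) (p q : nat)
    (L : {linear 'M[R[i]]_p -> 'M[R[i]]_q}) : Prop :=
  forall X, \tr (L X) = \tr X.

Definition quantum_channel (R : realType) (p q : nat)
    (L : {linear 'M[R[i]]_p -> 'M[R[i]]_q}) : Prop :=
  completely_positive L /\ trace_preserving L.

(* Completely PPT-preserving bipartite channels AB -> A'B',
   with dimensions a, b, a', b'. *)
Definition PPT_channel (R : realType) (a b a' b' : nat)
    (N : {linear 'M[R[i]]_(a * b) -> 'M[R[i]]_(a' * b')}) : Prop :=
  quantum_channel N /\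
  completely_positive (@ptrans R a' b' \o (N \o @ptrans R a b)).

Definition max_ent (R : realType) (d : nat) : 'M[R[i]]_(d * d) :=
  d%:R^-1 *: \sum_(i < d) \sum_(j < d) delta_mx i j *t delta_mx i j.

(* The tensor product of operators on A|B and A'|B', regarded as an operator
   on AA'|BB'. *)
Definition bitens (R : realType) (a b a' b' : nat)
    (X : 'M[R[i]]_(a * b)) (Y : 'M[R[i]]_(a' * b')) :
    'M[R[i]]_((a * a') * (b * b')) :=
  \matrix_(u, v)
    let: (uA, uB) := mxtens_unindex u in
    let: (vA, vB) := mxtens_unindex v in
    let: (iA, iA') := mxtens_unindex uA in
    let: (iB, iB') := mxtens_unindex uB in
    let: (jA, jA') := mxtens_unindex vA in
    let: (jB, jB') := mxtens_unindex vB in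
    X (mxtens_index (iA, iB)) (mxtens_index (jA, jB)) *
    Y (mxtens_index (iA', iB')) (mxtens_index (jA', jB')).

(* Tensor powers across the cut A^n|B^n. As for ntensmx, the recursion starts
   at exponent 1 because a ^ 1 is convertible to a, and a ^ k.+2 to
   a * a ^ k.+1. *)
Fixpoint bipow_rec (R : realType) (a b : nat) (X : 'M[R[i]]_(a * b)) (k : nat) :
    'M[R[i]]_(a ^ k.+1 * b ^ k.+1) :=
  if k is k'.+1 then bitens X (bipow_rec X k') else X.

Definition bipow (R : realType) (a b : nat) (X : 'M[R[i]]_(a * b)) (n : nat) :
    'M[R[i]]_(a ^ n * b ^ n) :=
  if n is k.+1 return 'M[R[i]]_(a ^ n * b ^ n) then bipow_rec X k else 1%:M.

Definition log2 (R : realType) (x : R) : R := ln x / ln 2.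

Definition E_PPT1 (R : realType) (a b : nat) (rho : 'M[R[i]]_(a * b)) : \bar R :=
  ereal_inf [set (log2 (d%:R : R))%:E | d in
    [set d : nat | (0 < d)%N /\
      exists Lambda : {linear 'M[R[i]]_(d * d) -> 'M[R[i]]_(a * b)},
        PPT_channel Lambda /\ rho = Lambda (max_ent R d)]].

(* The term n = 0, where 0^-1 = 0, is irrelevant to the limit superior. *)
Definition E_PPT (R : realType) (a b : nat) (rho : 'M[R[i]]_(a * b)) : \bar R :=
  limn_esup (fun n => ((n%:R : R)^-1)%:E * E_PPT1 (bipow rho n))%E.

Definition is_distr (R : realType) (k : nat) (p : 'I_k -> R) : Prop :=
  (forall z, 0 <= p z) /\ \sum_(z < k) p z = 1.

(* Main.v *)
(* The counterexample is the equal mixture of Phi^2 and |00><00|. The former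
   costs at most 1 (identity channel) and the latter nothing (discard the input
   and prepare a diagonal state), so the average cost is at most 1/2, whereas
   the mixture costs at least log2(3/2).

   The lower bound is the logarithmic negativity bound, with the flip
   F = n Phi^(T_B) as dual witness. If sigma = Lambda(Phi^d) with Lambda
   C-PPT-P, then n <Phi^n| sigma |Phi^n> = tr(F sigma^(T_B)) =
   tr(F N(F_d)) / d for the channel N = T_B o Lambda o T_B, and -1 <= F <= 1
   bounds this by tr N(1) / d = d. The overlap n <Phi^n| sigma |Phi^n> is
   multiplicative under tensor powers and equals (2 + 1) / 2 at the mixture. *)
Require Import Defs.
From HB Require Import structures.
From mathcomp Require Import all_boot all_order all_algebra.
From mathcomp Require Import all_classical all_reals all_analysis.
From mathcomp Require Import complex mxtens ring lra.

Set Implicit Arguments.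
Unset Strict Implicit.
Unset Printing Implicit Defensive.

Import Order.TTheory GRing.Theory Num.Theory.

Local Open Scope complex_scope.
Local Open Scope ring_scope.

(** * Sums and equalities over product indices *)

Lemma sum_mxtens_index (V : nmodType) (m n : nat) (F : 'I_(m * n) -> V) :
  \sum_u F u = \sum_i \sum_j F (mxtens_index (i, j)).
Proof.
rewrite pair_big /= (reindex (@mxtens_index m n)) /=; last first.
  exists (@mxtens_unindex m n) => u _; first exact: mxtens_indexK.
  exact: mxtens_unindexK.
by apply: eq_bigr => -[].
Qed.

Lemma mxtens_index_eq (m n : nat) (i k : 'I_m) (j l : 'I_n) :
  (mxtens_index (i, j) == mxtens_index (k, l)) = (i == k) && (j == l).
Proof. by rewrite (can_eq (@mxtens_indexK m n)). Qed.

Lemma matrix_tensP (T : Type) (m n p q : nat) (X Y : 'M[T]_(m * n, p * q)) :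
  (forall i j k l, X (mxtens_index (i, j)) (mxtens_index (k, l)) =
                   Y (mxtens_index (i, j)) (mxtens_index (k, l))) -> X = Y.
Proof.
move=> XY; apply/matrixP => u v.
by case: (mxtens_indexP u) => i j; case: (mxtens_indexP v) => k l; apply: XY.
Qed.

(** Used from right to left: a single entry is expanded into a sum against a Kronecker delta, to be
    matched term by term with a matrix product. *)
Lemma sum_delta (A : pzSemiRingType) (m : nat) (i : 'I_m) (F : 'I_m -> A) :
  \sum_k (i == k)%:R * F k = F i.
Proof.
rewrite (bigD1 i) //= eqxx mul1r big1 ?addr0 // => k ki.
by rewrite eq_sym (negPf ki) mul0r.
Qed.

Lemma natrb_and (A : pzSemiRingType) (x y : bool) : (x && y)%:R = x%:R * y%:R :> A.
Proof. by rewrite -natrM mulnb. Qed.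

Section PPT.
Variable R : realType.
Local Notation C := R[i].
Local Notation "A ^H" := (map_mx Num.conj A)^T (at level 1, format "A ^H").

(** * Positive semidefinite matrices as Hermitian forms *)

Lemma psd_formE n (X : 'M[C]_n) (v : 'cV[C]_n) :
  (v^H *m X *m v) 0 0 = \sum_i \sum_j (v i 0)^* * X i j * v j 0.
Proof.
rewrite mxE exchange_big /=; apply: eq_bigr => j _.
by rewrite mxE mulr_suml; apply: eq_bigr => i _; rewrite !mxE.
Qed.

Lemma psdP n (X : 'M[C]_n) :
  psd X <-> forall f : 'I_n -> C, 0 <= \sum_i \sum_j (f i)^* * X i j * f j.
Proof.
split=> [psdX f | H v]; last by rewrite psd_formE; apply: H.
have := psdX (\col_i f i); rewrite psd_formE.
by under eq_bigr do under eq_bigr do rewrite !mxE.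
Qed.

Lemma psd_gram m n (A : 'M[C]_(m, n)) : psd (A^H *m A).
Proof.
move=> v; have -> : v^H *m (A^H *m A) *m v = (A *m v)^H *m (A *m v).
  by rewrite map_mxM trmx_mul !mulmxA.
rewrite mxE sumr_ge0 // => i _; rewrite !mxE mulrC; exact: mul_conjC_ge0.
Qed.

Lemma psdZ n (c : C) (X : 'M[C]_n) : 0 <= c -> psd X -> psd (c *: X).
Proof.
move=> c0 psdX v.
by rewrite -scalemxAr -scalemxAl mxE mulr_ge0 //; apply: psdX.
Qed.

(** By cyclicity the trace is that of A^H Y A, the sum of the forms of Y at the columns of A. *)
Lemma mxtrace_gram_psd_ge0 m n (A : 'M[C]_(n, m)) (Y : 'M[C]_n) :
  psd Y -> 0 <= \tr (A *m A^H *m Y).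
Proof.
move=> psdY; rewrite -mulmxA mxtrace_mulC sumr_ge0 // => k _.
have := psdY (col k A); rewrite psd_formE => H.
apply: le_trans H _; rewrite le_eqVlt; apply/orP; left; apply/eqP.
rewrite mxE exchange_big /=; apply: eq_bigr => j _.
by rewrite !mxE mulr_suml; apply: eq_bigr => i _; rewrite !mxE.
Qed.

(** * Entries of the partial transpose, of [max_ent] and of [id_tens] *)

Lemma delta_tens_mulmxE a b n (X : 'M[C]_(a * b, n)) (p q j : 'I_b) (i : 'I_a) v :
  (((1%:M : 'M[C]_a) *t delta_mx p q) *m X) (mxtens_index (i, j)) v =
  (p == j)%:R * X (mxtens_index (i, q)) v.
Proof.
rewrite mxE sum_mxtens_index -(sum_delta i (fun k => _ * X (mxtens_index (k, q)) v)).
apply: eq_bigr => k _; rewrite -(sum_delta q (fun l => _ * X (mxtens_index (k, l)) v)).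
rewrite mulr_sumr; apply: eq_bigr => l _.
by rewrite tensmxE !mxE natrb_and [j == p]eq_sym [l == q]eq_sym; ring.
Qed.

Lemma mulmx_delta_tensE a b n (X : 'M[C]_(n, a * b)) (p q l : 'I_b) (k : 'I_a) u :
  (X *m ((1%:M : 'M[C]_a) *t delta_mx p q)) u (mxtens_index (k, l)) =
  (q == l)%:R * X u (mxtens_index (k, p)).
Proof.
rewrite mxE sum_mxtens_index -(sum_delta k (fun k => _ * X u (mxtens_index (k, p)))).
apply: eq_bigr => i _; rewrite -(sum_delta p (fun j => _ * X u (mxtens_index (i, j)))).
rewrite mulr_sumr; apply: eq_bigr => j _.
rewrite tensmxE !mxE natrb_and [i == k]eq_sym [j == p]eq_sym [l == q]eq_sym; ring.
Qed.

(** In the defining double sum only the term p = j, q = l contributes to this entry. *)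
Lemma ptransE a b (X : 'M[C]_(a * b)) i j k l :
  ptrans X (mxtens_index (i, j)) (mxtens_index (k, l)) =
  X (mxtens_index (i, l)) (mxtens_index (k, j)).
Proof.
rewrite /ptrans summxE.
rewrite -(sum_delta j (fun p => X (mxtens_index (i, l)) (mxtens_index (k, p)))).
apply: eq_bigr => p _; rewrite summxE.
rewrite -(sum_delta l (fun q => X (mxtens_index (i, q)) (mxtens_index (k, p)))).
rewrite mulr_sumr; apply: eq_bigr => q _.
by rewrite mulmx_delta_tensE delta_tens_mulmxE [p == j]eq_sym [q == l]eq_sym; ring.
Qed.

Lemma ptransK a b : involutive (@ptrans R a b).
Proof. by move=> X; apply: matrix_tensP => i j k l; rewrite !ptransE. Qed.

Lemma mxtrace_ptrans a b (X : 'M[C]_(a * b)) : \tr (ptrans X) = \tr X.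
Proof.
rewrite /mxtrace !sum_mxtens_index.
by apply: eq_bigr => i _; apply: eq_bigr => j _; rewrite ptransE.
Qed.

(** Exchanging the two Bob indices fixes every diagonal entry and sends off-diagonal positions to
    off-diagonal ones, where X vanishes. *)
Lemma ptrans_diag a b (X : 'M[C]_(a * b)) : is_diag_mx X -> ptrans X = X.
Proof.
move=> /is_diag_mxP Xd; apply: matrix_tensP => i j k l; rewrite ptransE.
have D u v : u != v -> X u v = 0 by exact: Xd.
have [<-|nik] := eqVneq i k; last by rewrite !D ?mxtens_index_eq // negb_and nik.
have [<- //|njl] := eqVneq j l.
by rewrite !D // mxtens_index_eq eqxx //= eq_sym.
Qed.

Lemma sum_delta_tensE k p q (F : 'I_k -> 'I_k -> 'M[C]_(p, q)) i j s t :
  (\sum_i' \sum_j' delta_mx i' j' *t F i' j')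
    (mxtens_index (i, s)) (mxtens_index (j, t)) = F i j s t.
Proof.
rewrite summxE -(sum_delta i (fun i' => F i' j s t)).
apply: eq_bigr => i' _; rewrite summxE -(sum_delta j (fun j' => F i' j' s t)).
rewrite mulr_sumr; apply: eq_bigr => j' _.
by rewrite tensmxE !mxE natrb_and; ring.
Qed.

Lemma max_entE d (i j k l : 'I_d) :
  max_ent R d (mxtens_index (i, j)) (mxtens_index (k, l)) =
  d%:R^-1 * ((i == j)%:R * (k == l)%:R).
Proof.
by rewrite mxE sum_delta_tensE mxE natrb_and [j == i]eq_sym [l == k]eq_sym.
Qed.

Lemma tens_blockE k p (X : 'M[C]_(k * p)) i j s t :
  tens_block X i j s t = X (mxtens_index (i, s)) (mxtens_index (j, t)).
Proof. by rewrite mxE. Qed.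

Lemma id_tensE k p q (L : {linear 'M[C]_p -> 'M[C]_q}) (X : 'M[C]_(k * p)) i j s t :
  id_tens L X (mxtens_index (i, s)) (mxtens_index (j, t)) =
  L (tens_block X i j) s t.
Proof. exact: sum_delta_tensE. Qed.

(** * Complete positivity *)

Lemma eq_completely_positive p q (L M : {linear 'M[C]_p -> 'M[C]_q}) :
  L =1 M -> completely_positive L -> completely_positive M.
Proof.
move=> LM cpL k X /cpL; congr psd; apply: matrix_tensP => i s j t.
by rewrite !id_tensE LM.
Qed.

Lemma completely_positive_id p : 
  completely_positive (idfun : {linear 'M[C]_p -> 'M[C]_p}).
Proof.
move=> k X; congr psd; apply: matrix_tensP => i s j t.
by rewrite id_tensE tens_blockE.
Qed.

(** This is the case k = 1 of complete positivity; [X1] is X with its indices relabelled from p to 1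
    * p. *)
Lemma completely_positive_psd p q (L : {linear 'M[C]_p -> 'M[C]_q}) (X : 'M[C]_p) :
  completely_positive L -> psd X -> psd (L X).
Proof.
move=> cpL /psdP psdX.
pose X1 : 'M[C]_(1 * p) :=
  \matrix_(u, v) X (mxtens_unindex u).2 (mxtens_unindex v).2.
have blockX1 : tens_block X1 0 0 = X.
  by apply/matrixP => s t; rewrite tens_blockE mxE !mxtens_indexK.
have /cpL /psdP psdLX : psd X1.
  apply/psdP => f; have := psdX (fun s => f (mxtens_index (0, s))).
  congr (0 <= _); rewrite sum_mxtens_index big_ord1; apply: eq_bigr => s _.
  rewrite sum_mxtens_index big_ord1; apply: eq_bigr => t _.
  by rewrite mxE !mxtens_indexK.
apply/psdP => f; have := psdLX (fun u => f (mxtens_unindex u).2).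
congr (0 <= _); rewrite sum_mxtens_index big_ord1; apply: eq_bigr => s _.
rewrite sum_mxtens_index big_ord1; apply: eq_bigr => t _.
by rewrite id_tensE blockX1 !mxtens_indexK.
Qed.

(** * The flip operator and the bound on the overlap with Phi^n *)

Definition flip_mx n : 'M[C]_(n * n) :=
  \matrix_(u, v) (((mxtens_unindex u).1 == (mxtens_unindex v).2)%:R *
                 ((mxtens_unindex u).2 == (mxtens_unindex v).1)%:R).

Lemma flip_mxE n (i j k l : 'I_n) :
  flip_mx n (mxtens_index (i, j)) (mxtens_index (k, l)) =
  (i == l)%:R * (j == k)%:R.
Proof. by rewrite mxE !mxtens_indexK. Qed.

Lemma flip_mulmxE n (X : 'M[C]_(n * n)) i j v :
  (flip_mx n *m X) (mxtens_index (i, j)) v = X (mxtens_index (j, i)) v.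
Proof.
rewrite mxE sum_mxtens_index -(sum_delta j (fun k => X (mxtens_index (k, i)) v)).
apply: eq_bigr => k _; rewrite -(sum_delta i (fun l => X (mxtens_index (k, l)) v)).
rewrite mulr_sumr; apply: eq_bigr => l _.
by rewrite flip_mxE; ring.
Qed.

Lemma flip_mxK n : flip_mx n *m flip_mx n = 1%:M.
Proof.
apply: matrix_tensP => i j k l.
by rewrite flip_mulmxE flip_mxE mxE mxtens_index_eq -natrM mulnb andbC.
Qed.

Lemma flip_mx_adj n : (flip_mx n)^H = flip_mx n.
Proof.
apply: matrix_tensP => i j k l; rewrite !mxE !mxtens_indexK /= rmorphM /= !conjC_nat.
by rewrite mulrC [k == j]eq_sym [l == i]eq_sym.
Qed.

Lemma flip_ptrans_max_ent d :
  (0 < d)%N -> flip_mx d = d%:R *: ptrans (max_ent R d).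
Proof.
move=> d0; apply: matrix_tensP => i j k l.
rewrite flip_mxE mxE ptransE max_entE mulVKf ?pnatr_eq0 -?lt0n //.
by rewrite [k == j]eq_sym.
Qed.

(** This is n <Phi^n| X |Phi^n>; the factor n cancels the normalization of Phi^n. *)
Definition max_ent_overlap n (X : 'M[C]_(n * n)) : C :=
  \sum_i \sum_j X (mxtens_index (i, i)) (mxtens_index (j, j)).

(** Row (i, j) of F Y is row (j, i) of Y, and the entry ((j, i), (i, j)) of T_B(X) is the entry ((j,
    j), (i, i)) of X. *)
Lemma max_ent_overlapE n (X : 'M[C]_(n * n)) :
  max_ent_overlap X = \tr (flip_mx n *m ptrans X).
Proof.
rewrite /mxtrace sum_mxtens_index [RHS]exchange_big /=.
by apply: eq_bigr => i _; apply: eq_bigr => j _; rewrite flip_mulmxE ptransE.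
Qed.

(* For e = 1 and e = -1, P / 2 is an orthogonal projection. *)
Lemma flip_add_gram n (e : C) : e ^+ 2 = 1 -> e^* = e ->
  let P := 1%:M + e *: flip_mx n in P *m P^H = 2 *: P /\ P^H *m P = 2 *: P.
Proof.
move=> e2 er P; have Pa : P^H = P.
  rewrite /P map_mxD map_mx1 map_mxZ /= er linearD /= linearZ /= flip_mx_adj.
  by rewrite trmx1.
have PP : P *m P = 2 *: P.
  rewrite /P mulmxDl mul1mx mulmxDr mulmx1 -scalemxAl -scalemxAr flip_mxK.
  by rewrite scalerA -expr2 e2 scale1r [e *: _ + _]addrC -mulr2n scaler_nat.
by rewrite Pa PP.
Qed.

(** P^H P = 2 P makes P half of a Gram matrix. *)
Lemma psd_flip_add n (e : C) : e ^+ 2 = 1 -> e^* = e ->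
  psd (1%:M + e *: flip_mx n).
Proof.
move=> e2 er; have [_ /= G] := flip_add_gram n e2 er.
set P := (X in psd X) in G *; have -> : P = 2^-1 *: (P^H *m P).
  by rewrite G scalerA mulVf ?scale1r // pnatr_eq0.
by apply: psdZ; [rewrite invr_ge0 ler0n | exact: psd_gram].
Qed.

Lemma mxtrace_flip_add n (e : C) Y : e ^+ 2 = 1 -> e^* = e -> psd Y ->
  0 <= \tr ((1%:M + e *: flip_mx n) *m Y).
Proof.
move=> e2 er psdY; have [/= G _] := flip_add_gram n e2 er.
set P := (X in \tr (X *m _)) in G *; have -> : P = 2^-1 *: (P *m P^H).
  by rewrite G scalerA mulVf ?scale1r // pnatr_eq0.
rewrite -scalemxAl mxtraceZ mulr_ge0 ?invr_ge0 ?ler0n //.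
exact: mxtrace_gram_psd_ge0.
Qed.

(* Since 1 + F and 1 - F are positive, so are both summands of
   \tr ((1 - F) N(1 + F)) + \tr ((1 + F) N(1 - F)) = 2 d^2 - 2 \tr (F N(F)). *)
Lemma mxtrace_flip_channel_le d n (N : {linear 'M[C]_(d * d) -> 'M[C]_(n * n)}) :
  quantum_channel N -> \tr (flip_mx n *m N (flip_mx d)) <= d%:R * d%:R.
Proof.
move=> [cpN tpN].
have pos (e : C) : e ^+ 2 = 1 -> e^* = e ->
    0 <= \tr ((1%:M + - e *: flip_mx n) *m N (1%:M + e *: flip_mx d)).
  move=> e2 er; apply: mxtrace_flip_add; first by rewrite sqrrN.
    by rewrite rmorphN /= er.
  exact: (completely_positive_psd cpN (psd_flip_add e2 er)).
have expand (e : C) : e ^+ 2 = 1 ->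
    \tr ((1%:M + - e *: flip_mx n) *m N (1%:M + e *: flip_mx d)) =
    d%:R * d%:R - e * \tr (flip_mx n *m N 1%:M) + e * \tr (flip_mx d)
      - \tr (flip_mx n *m N (flip_mx d)).
  move=> e2; rewrite (linearD N) (linearZ_LR N) /= mulmxDl mul1mx !mulmxDr.
  rewrite -!scalemxAr -!scalemxAl !mxtraceD !mxtraceZ !tpN mxtrace1 natrM.
  (* The coefficient 1 of the last term is written as e^2, so that [ring] closes the goal for an
     indeterminate e. *)
  rewrite -[X in _ - X]mul1r -e2; ring.
have e1 : (-1 : C) ^+ 2 = 1 by rewrite sqrrN expr1n.
have P1 := pos 1 (expr1n _ _) (rmorph1 _).
have P2 := pos (-1) e1 (rmorphN1 _).
(* Adding the cases e = 1 and e = -1 cancels the terms linear in e. *)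
have H := addr_ge0 P1 P2; rewrite (expand _ (expr1n _ _)) (expand _ e1) in H.
rewrite -subr_ge0 -(pmulr_rge0 _ (ltr0Sn C 1)).
by move: H; congr (0 <= _); ring.
Qed.

Lemma max_ent_overlap_PPT d n (L : {linear 'M[C]_(d * d) -> 'M[C]_(n * n)}) :
  (0 < d)%N -> PPT_channel L -> max_ent_overlap (L (max_ent R d)) <= d%:R.
Proof.
move=> d0 [[_ tpL] cpN].
have d1 : (0 : C) < d%:R by rewrite ltr0n.
(* Since d Phi^d = T_B(F_d), multiplying by d turns the claim into tr(F N(F_d)) <= d^2 with N = T_B
   o L o T_B. *)
rewrite -(ler_pM2l d1) max_ent_overlapE -mxtraceZ scalemxAr.
have -> : d%:R *: ptrans (L (max_ent R d)) = ptrans (L (ptrans (flip_mx d))).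
  rewrite flip_ptrans_max_ent //; move: (max_ent R d) => Y.
  by rewrite !linearZ /= ptransK.
apply: (mxtrace_flip_channel_le (N := @ptrans R n n \o (L \o @ptrans R d d))).
(* N is completely positive because L is C-PPT-P, and trace preserving because T_B preserves
   traces. *)
by split=> // X; rewrite /= mxtrace_ptrans tpL mxtrace_ptrans.
Qed.

(** * Tensor products across the bipartite cut *)

Lemma bitensE a b a' b' (X : 'M[C]_(a * b)) (Y : 'M[C]_(a' * b')) i i' j j' k k' l l' :
  bitens X Y (mxtens_index (mxtens_index (i, i'), mxtens_index (j, j')))
             (mxtens_index (mxtens_index (k, k'), mxtens_index (l, l'))) =
  X (mxtens_index (i, j)) (mxtens_index (k, l)) *
  Y (mxtens_index (i', j')) (mxtens_index (k', l')).
Proof. by rewrite mxE !mxtens_indexK. Qed.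

Lemma max_ent_overlap_bitens m n (X : 'M[C]_(m * m)) (Y : 'M[C]_(n * n)) :
  max_ent_overlap (bitens X Y) = max_ent_overlap X * max_ent_overlap Y.
Proof.
rewrite /max_ent_overlap sum_mxtens_index mulr_suml; apply: eq_bigr => i _.
rewrite mulr_sumr; apply: eq_bigr => i' _.
rewrite sum_mxtens_index mulr_suml; apply: eq_bigr => j _.
by rewrite mulr_sumr; apply: eq_bigr => j' _; rewrite bitensE.
Qed.

Lemma max_ent_overlap_bipow n (X : 'M[C]_(n * n)) k :
  max_ent_overlap (bipow X k.+1) = max_ent_overlap X ^+ k.+1.
Proof.
elim: k => [|k IHk]; first by rewrite expr1.
by rewrite exprS -IHk -max_ent_overlap_bitens.
Qed.

Lemma max_ent_overlapD n (X Y : 'M[C]_(n * n)) :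
  max_ent_overlap (X + Y) = max_ent_overlap X + max_ent_overlap Y.
Proof.
rewrite /max_ent_overlap -big_split; apply: eq_bigr => i _ /=.
by rewrite -big_split; apply: eq_bigr => j _ /=; rewrite mxE.
Qed.

Lemma max_ent_overlapZ n c (X : 'M[C]_(n * n)) :
  max_ent_overlap (c *: X) = c * max_ent_overlap X.
Proof.
rewrite /max_ent_overlap mulr_sumr; apply: eq_bigr => i _.
by rewrite mulr_sumr; apply: eq_bigr => j _; rewrite mxE.
Qed.

Lemma max_ent_overlap_max_ent d : (0 < d)%N -> max_ent_overlap (max_ent R d) = d%:R.
Proof.
move=> d0; rewrite /max_ent_overlap.
under eq_bigr do under eq_bigr do rewrite max_entE !eqxx !mulr1.
have dd : d%:R^-1 *+ d = 1 :> C by rewrite -[LHS]mulr_natr mulVf ?pnatr_eq0 -?lt0n.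
by rewrite !sumr_const card_ord dd.
Qed.

(** The pairs (i, i') and (j, j') agree exactly when both components do, so the Kronecker deltas of
    the two factors multiply to those of the product. *)
Lemma bitens_max_ent m n : bitens (max_ent R m) (max_ent R n) = max_ent R (m * n).
Proof.
apply: matrix_tensP => u v w z.
case: (mxtens_indexP u) (mxtens_indexP v) => i i' [j j'].
case: (mxtens_indexP w) (mxtens_indexP z) => k k' [l l'].
rewrite bitensE !max_entE !mxtens_index_eq !natrb_and natrM invfM; ring.
Qed.

Lemma bipow_max_ent d k : bipow (max_ent R d) k.+1 = max_ent R (d ^ k.+1).
Proof. by elim: k => [//|k IHk]; rewrite -[RHS]bitens_max_ent -IHk. Qed.

Lemma mxtrace_bitens a b a' b' (X : 'M[C]_(a * b)) (Y : 'M[C]_(a' * b')) :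
  \tr (bitens X Y) = \tr X * \tr Y.
Proof.
rewrite /mxtrace !sum_mxtens_index mulr_suml; apply: eq_bigr => i _.
under [LHS]eq_bigr do rewrite sum_mxtens_index.
rewrite exchange_big mulr_suml; apply: eq_bigr => j _.
rewrite mulr_sumr; apply: eq_bigr => i' _.
by rewrite mulr_sumr; apply: eq_bigr => j' _; rewrite bitensE.
Qed.

(** * Diagonal states and the channels that prepare them *)

Definition diag_state n (X : 'M[C]_n) : Prop :=
  [/\ is_diag_mx X, forall u, 0 <= X u u & \tr X = 1].

Lemma diag_state_bitens a b a' b' (X : 'M[C]_(a * b)) (Y : 'M[C]_(a' * b')) :
  diag_state X -> diag_state Y -> diag_state (bitens X Y).
Proof.
move=> [Xd X0 X1] [Yd Y0 Y1]; split; last by rewrite mxtrace_bitens X1 Y1 mulr1.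
- apply/is_diag_mxP => u v.
  case: (mxtens_indexP u) => uA uB; case: (mxtens_indexP v) => vA vB.
  case: (mxtens_indexP uA) (mxtens_indexP uB) => i i' [j j'].
  case: (mxtens_indexP vA) (mxtens_indexP vB) => k k' [l l'].
  (* Distinct positions differ in their unprimed or in their primed indices, so X or Y contributes
     an off-diagonal zero. *)
  rewrite bitensE => uv; have [e|n] := eqVneq (mxtens_index (i, j)) (mxtens_index (k, l)).
    move/is_diag_mxP: Yd => ->; first by rewrite mulr0.
    apply: contraNneq uv => /val_inj /(can_inj (@mxtens_indexK _ _))[-> ->].
    by move: e => /(can_inj (@mxtens_indexK _ _))[-> ->].
  by move/is_diag_mxP: Xd => -> //; rewrite mul0r.
- move=> u; case: (mxtens_indexP u) => uA uB.
  case: (mxtens_indexP uA) (mxtens_indexP uB) => i i' [j j'].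
  by rewrite bitensE mulr_ge0.
Qed.

Lemma diag_state_bipow a b (X : 'M[C]_(a * b)) k :
  diag_state X -> diag_state (bipow X k.+1).
Proof. by move=> Xs; elim: k => [//|k IHk]; apply: diag_state_bitens. Qed.

Lemma psd_form_diag n (X : 'M[C]_n) (f : 'I_n -> C) : is_diag_mx X ->
  \sum_i \sum_j (f i)^* * X i j * f j = \sum_i X i i * ((f i)^* * f i).
Proof.
move=> /is_diag_mxP Xd; apply: eq_bigr => i _; rewrite (bigD1 i) //= big1.
  by rewrite addr0; ring.
by move=> j ji; rewrite Xd ?mulr0 ?mul0r // eq_sym.
Qed.

Lemma is_state_diag n (X : 'M[C]_n) : diag_state X -> is_state X.
Proof.
move=> [Xd X0 X1]; split=> //; apply/psdP => f; rewrite psd_form_diag //.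
by apply: sumr_ge0 => i _; rewrite mulr_ge0 // mulrC mul_conjC_ge0.
Qed.

Definition prepare p q (S : 'M[C]_q) (X : 'M[C]_p) : 'M[C]_q := \tr X *: S.

Lemma prepare_is_linear p q S : linear (@prepare p q S).
Proof. by move=> c X Y; rewrite /prepare mxtraceD mxtraceZ scalerDl scalerA. Qed.

HB.instance Definition _ p q S :=
  GRing.isLinear.Build C 'M[C]_p 'M[C]_q *:%R (@prepare p q S) (@prepare_is_linear p q S).

(** id_k (x) [prepare S] sends X to Tr_2(X) (x) S. As S is diagonal with nonnegative entries, the
    form of the image is a nonnegative combination of forms of X. *)
Lemma completely_positive_prepare p q (S : 'M[C]_q) :
  diag_state S -> completely_positive (@prepare p q S).
Proof.
move=> [/is_diag_mxP Sd S0 _] k X /psdP psdX; apply/psdP => f.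
(* The form of X at the vectors \sum_i f (i, s) e_i (x) e_r, weighted by S s s. *)
have -> : \sum_u \sum_v (f u)^* * id_tens (@prepare p q S) X u v * f v =
    \sum_s S s s * \sum_r \sum_i \sum_j (f (mxtens_index (i, s)))^* *
      X (mxtens_index (i, r)) (mxtens_index (j, r)) * f (mxtens_index (j, s)).
  rewrite sum_mxtens_index exchange_big; apply: eq_bigr => s _ /=.
  rewrite [X in _ = _ * X]exchange_big mulr_sumr /=; apply: eq_bigr => i _.
  rewrite sum_mxtens_index [X in _ = _ * X]exchange_big mulr_sumr /=.
  apply: eq_bigr => j _.
  rewrite (bigD1 s) //= big1 ?addr0 => [|t ts]; last first.
    by rewrite id_tensE mxE Sd ?mulr0 ?mul0r // eq_sym.
  rewrite id_tensE mxE mulr_sumr /mxtrace !(mulr_suml, mulr_sumr).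
  by apply: eq_bigr => r _; rewrite tens_blockE; ring.
apply: sumr_ge0 => s _; rewrite mulr_ge0 //; apply: sumr_ge0 => r _.
have := psdX (fun u => (r == (mxtens_unindex u).2)%:R *
                       f (mxtens_index ((mxtens_unindex u).1, s))).
congr (0 <= _); rewrite sum_mxtens_index; apply: eq_bigr => i _.
rewrite -(sum_delta r (fun r' => \sum_j (f (mxtens_index (i, s)))^* *
      X (mxtens_index (i, r')) (mxtens_index (j, r)) * f (mxtens_index (j, s)))).
apply: eq_bigr => r1 _; rewrite sum_mxtens_index mulr_sumr; apply: eq_bigr => j _.
rewrite -(sum_delta r (fun r' => _ * X _ (mxtens_index (j, r')) * _)) mulr_sumr.
apply: eq_bigr => r2 _; rewrite !mxtens_indexK /= rmorphM /= conjC_nat; ring.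
Qed.

(** Conjugation by T_B leaves the map unchanged: T_B preserves the trace of the input and fixes the
    diagonal output S. *)
Lemma PPT_channel_prepare a b a' b' (S : 'M[C]_(a' * b')) : diag_state S ->
  PPT_channel (@prepare (a * b) (a' * b') S : {linear 'M[C]_(a * b) -> 'M[C]_(a' * b')}).
Proof.
move=> Ss; have cpS := completely_positive_prepare (p := (a * b)%N) Ss.
case: (Ss) => [Sd _ S1]; split; first by split=> // X; rewrite mxtraceZ S1 mulr1.
apply: eq_completely_positive cpS => X /=.
by rewrite /prepare mxtrace_ptrans linearZ /= ptrans_diag.
Qed.

(** T_B is an involution, so conjugating the identity by it gives the identity. *)
Lemma PPT_channel_id a b :
  PPT_channel (idfun : {linear 'M[C]_(a * b) -> 'M[C]_(a * b)}).
Proof.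
split; first by split=> //; apply: completely_positive_id.
by apply: eq_completely_positive (@completely_positive_id _) => X /=; rewrite ptransK.
Qed.

Lemma is_state_max_ent d : (0 < d)%N -> is_state (max_ent R d).
Proof.
move=> d0; split.
  apply/psdP => f.
  (* The form at f is |<v, f>|^2 / d with v the sum of the e_i (x) e_i. *)
  have -> : \sum_u \sum_v (f u)^* * max_ent R d u v * f v =
      d%:R^-1 * ((\sum_i f (mxtens_index (i, i))) * (\sum_i f (mxtens_index (i, i)))^*).
    rewrite sum_mxtens_index [X in _ * X]mulrC rmorph_sum mulr_suml mulr_sumr.
    apply: eq_bigr => i _ /=.
    rewrite -(sum_delta i (fun j => d%:R^-1 * ((f (mxtens_index (i, j)))^* *
      \sum_k f (mxtens_index (k, k))))).
    apply: eq_bigr => j _; rewrite sum_mxtens_index !mulr_sumr.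
    apply: eq_bigr => k _; rewrite -(sum_delta k (fun l => f (mxtens_index (k, l)))).
    by rewrite !mulr_sumr; apply: eq_bigr => l _; rewrite max_entE; ring.
  by rewrite mulr_ge0 ?invr_ge0 ?ler0n ?mul_conjC_ge0.
rewrite /mxtrace sum_mxtens_index.
have -> : \sum_(i < d) \sum_(j < d) max_ent R d (mxtens_index (i, j)) (mxtens_index (i, j))
   = \sum_(i < d) d%:R^-1.
  apply: eq_bigr => i _; rewrite -(sum_delta i (fun=> d%:R^-1)).
  by apply: eq_bigr => j _; rewrite max_entE -natrb_and andbb mulrC.
by rewrite sumr_const card_ord -[LHS]mulr_natr mulVf ?pnatr_eq0 -?lt0n.
Qed.

(** * Limits superior and bounds on the asymptotic cost *)

Local Open Scope classical_set_scope.
Local Open Scope ereal_scope.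

Lemma limn_esup_le (u : (\bar R)^nat) (c : \bar R) :
  (forall n, u n <= c) -> limn_esup u <= c.
Proof.
move=> uc; apply: (@le_trans _ _ (ereal_sup (range u))).
  (* The limit superior is an infimum of suprema over neighbourhoods of infinity; the set of all
     indices is one of them. *)
  by apply: ereal_inf_lbound; exists setT => //; apply: filterT.
by apply: ge_ereal_sup => _ [n _ <-].
Qed.

Lemma limn_esup_ge (u : (\bar R)^nat) (c : \bar R) :
  (forall n, c <= u n.+1) -> c <= limn_esup u.
Proof.
move=> uc; apply: le_ereal_inf_tmp => _ [V [N _ NV] <-].
(* V contains all indices from N on; N + 1 is one of them and is never 0, where u is not
   controlled. *)
apply: (le_trans (uc N)); apply: ereal_sup_ubound; exists N.+1 => //.
by apply: NV => /=.
Qed.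

Lemma log2X (x : R) n : (0 < x)%R -> log2 (x ^+ n) = (n%:R * log2 x)%R.
Proof. by move=> x0; rewrite /log2 lnXn // mulr_natl mulrnAl. Qed.

Lemma ln2_gt0 : (0 < ln 2 :> R)%R.
Proof. by rewrite ln_gt0 // ltr1n. Qed.

Lemma E_PPT_le a b (rho : 'M[C]_(a * b)) (x : R) : (0 <= x)%R ->
  (forall n, E_PPT1 (bipow rho n.+1) <= (n.+1%:R * x)%:E) -> E_PPT rho <= x%:E.
Proof.
(* The term at n = 0 equals 0, because 0^-1 = 0, and is bounded by x >= 0. *)
move=> x0 H; apply: limn_esup_le => -[|n]; first by rewrite invr0 mul0e lee_fin.
apply: (@le_trans _ _ ((n.+1%:R^-1)%:E * (n.+1%:R * x)%:E)).
  by rewrite lee_pmul2l ?lte_fin ?invr_gt0 ?ltr0n.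
by rewrite -EFinM mulKf // pnatr_eq0.
Qed.

Lemma E_PPT_max_ent_le d : (0 < d)%N -> E_PPT (max_ent R d) <= (log2 d%:R)%:E.
Proof.
move=> d0; apply: E_PPT_le => [|n].
  by rewrite divr_ge0 ?ln_ge0 ?ler1n.
(* The (n+1)-fold power of Phi^d is Phi^(d^(n+1)), obtained from itself by the identity channel. *)
rewrite -log2X ?ltr0n // -natrX; apply: ereal_inf_lbound; exists (d ^ n.+1)%N => //.
split; first by rewrite expn_gt0 d0.
by exists idfun; split; [exact: PPT_channel_id | rewrite bipow_max_ent].
Qed.

Lemma E_PPT_diag_le a b (S : 'M[C]_(a * b)) : diag_state S -> E_PPT S <= 0.
Proof.
move=> Ss; apply: E_PPT_le => // n; rewrite mulr0; apply: ereal_inf_lbound.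
(* Already Phi^1, the trivial resource with log2 1 = 0, suffices to prepare the diagonal power of
   S. *)
exists 1%N; last by rewrite /log2 ln1 mul0r.
have Sn := diag_state_bipow n Ss; split=> //; exists (prepare (bipow S n.+1)).
split; first exact: PPT_channel_prepare.
by rewrite /= /prepare (is_state_max_ent _).2 ?scale1r.
Qed.

Lemma E_PPT_ge n (rho : 'M[C]_(n * n)) (x : R) : (0 < x)%R ->
  max_ent_overlap rho = x%:C -> (log2 x)%:E <= E_PPT rho.
Proof.
move=> x0 ox; apply: limn_esup_ge => k.
have k0 : (0 < k.+1%:R^-1 :> R)%R by rewrite invr_gt0 ltr0n.
apply: (@le_trans _ _ ((k.+1%:R^-1)%:E * (log2 (x ^+ k.+1))%:E)).
  by rewrite -EFinM log2X // mulKf // pnatr_eq0.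
rewrite lee_pmul2l ?lte_fin //; apply: le_ereal_inf_tmp => _ [d [d0 [L [Lppt rhoL]]] <-].
(* Every admissible d is at least the overlap x^(k+1) of the power; this inequality in C is then
   brought back to R. *)
have := max_ent_overlap_PPT d0 Lppt; rewrite -rhoL max_ent_overlap_bipow ox.
rewrite -rmorphXn -(rmorph_nat (real_complex R)) lecR => xd.
rewrite lee_fin ler_pM2r ?invr_gt0 ?ln2_gt0 // ler_ln // posrE ?exprn_gt0 //.
by rewrite ltr0n.
Qed.

End PPT.

(** * The equal mixture of Phi^2 and |00><00| *)

Theorem proposition3 (R : realType) :
  exists (a b k : nat) (p : 'I_k -> R) (rho : 'I_k -> 'M[R[i]]_(a * b)),
    is_distr p /\ (forall z, is_state (rho z)) /\
    (\sum_(z < k) (p z)%:E * E_PPT (rho z) <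
       E_PPT (\sum_(z < k) (p z)%:C *: rho z)%R)%E.
Proof.
pose e : 'I_(2 * 2) := mxtens_index (0, 0).
have e_state : diag_state (delta_mx e e : 'M[R[i]]_(2 * 2)).
  split=> [|u|].
  - apply/is_diag_mxP => u v; apply: contraNeq; rewrite mxE.
    by have [->|] := eqVneq u e; have [->|] := eqVneq v e; rewrite ?eqxx.
  - by rewrite mxE ler0n.
  - rewrite /mxtrace (bigD1 e) //= mxE !eqxx big1 ?addr0 // => u /negbTE ue.
    by rewrite mxE ue.
exists 2%N, 2%N, 2%N, (fun=> 2^-1),
  (fun z => if z == 0 then max_ent R 2 else delta_mx e e).
split; last split.
- by split=> [z|]; rewrite ?invr_ge0 ?ler0n // !big_ord_recl big_ord0; lra.
- by move=> z; case: ifP => _; [exact: is_state_max_ent | exact: is_state_diag].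
rewrite !big_ord_recl !big_ord0 /= adde0 addr0.
have l2 := ln2_gt0 R.
(* The average cost is at most (1 + 0) / 2. *)
apply: (@le_lt_trans _ _ (2^-1)%:E).
  have h0 : (0 < (2^-1 : R)%:E)%E by rewrite lte_fin invr_gt0.
  rewrite -[leRHS]adde0; apply: leeD.
    rewrite -[leRHS]mule1 lee_pmul2l //.
    apply: le_trans (E_PPT_max_ent_le _ (ltn0Sn 1)) _.
    by rewrite lee_fin /log2 divff ?gt_eqF.
  by rewrite -[leRHS](mule0 (2^-1)%:E) lee_pmul2l // E_PPT_diag_le.
apply: (@lt_le_trans _ _ (log2 (3 / 2))%:E).
  (* 1/2 < log2(3/2) amounts to 2 < (3/2)^2 = 9/4. *)
  have : ln 2 < ln (3 / 2) *+ 2 :> R.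
    by rewrite -lnXn; [rewrite ltr_ln ?posrE; lra | lra].
  by rewrite lte_fin /log2 ltr_pdivlMr //; lra.
apply: E_PPT_ge; first by lra.
rewrite max_ent_overlapD max_ent_overlapZ max_ent_overlap_max_ent // max_ent_overlapZ.
have -> : max_ent_overlap (delta_mx e e : 'M[R[i]]_(2 * 2)) = 1.
  rewrite /max_ent_overlap !big_ord_recl !big_ord0 !mxE !mxtens_index_eq /=.
  by rewrite !addr0.
rewrite -(rmorph_nat (real_complex R)) mulr1 -rmorphM -rmorphD.
by congr (real_complex R _); field.
Qed.
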